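(* Let $S$ be an integral domain, $\sigma\in\mathrm{Aut}(S)$ of finite order $m$, $f(t)\in S[t;\sigma]$ a monic polynomial of degree $n$, and $b\in S^\times$. Suppose that $G:\mathbb{S}_f\to\mathbb{S}_{t^n-b}$ is a nonzero ring homomorphism whose restriction to $S$ is given by some automorphism $\tau\in\mathrm{Aut}(S)$ commuting with $\sigma$, and such that $G(t)$ is not a monomial. Then $m\mid n$ and $G(t)=p(t^m)t$ for some $p\in S[x]$ of degree less than $n/m$.
   Context: $S[t;\sigma]$ is the skew polynomial ring with $tc=\sigma(c)t$ for $c\in S$. For a monic $f\in S[t;\sigma]$ of degree $n$, every $g\in S[t;\sigma]$ can be written uniquely as $g=qf+r$ with $\deg r<n$; write $r=g \bmod_r f$. The Petit ring $\mathbb{S}_f$ is the additive group of skew polynomials of degree $<n$ with multiplication $g\circ h=gh \bmod_r f$; it is a unital, in general nonassociative, ring containing $S$ as the constants. ''Not a monomial'' means $G(t)$ is not of the form $ct^i$ with $c\in S$, i.e. it has at least two nonzero coefficients. For $p=\sum_j p_jx^j\in S[x]$, $p(t^m)t=\sum_jp_jt^{mj+1}$.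
   Formalization: The equality G(t)=p(t^m)t is taken in S_{t^n-b}, i.e. after reducing p(t^m)t modulo t^n-b; this changes nothing for m≥2, but for m=1 the literal polynomial equality can fail (S=Q, σ=id, f=(t-1)^2-2, b=2, G(t)=t+1). *)

(* Defs.v *)
From HB Require Import structures.
From mathcomp Require Import all_boot all_order all_algebra zify.

Set Implicit Arguments.
Unset Strict Implicit.
Unset Printing Implicit Defensive.

Import GRing.Theory.
Local Open Scope ring_scope.

(* An element of S[t; sigma] is the sequence of its left coefficients. As an  *)
(* additive group skewpoly sigma is {poly S}, which also provides size and    *)
(* coefficients; the product is the one determined by t * c = sigma c * t,    *)
(* that is, (a t^i) (b t^j) = a sigma^i(b) t^(i + j).                         *)
Definition skewpoly (S : nzRingType) (sigma : {rmorphism S -> S}) : Type :=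
  {poly S}.

Section SkewPoly.

Variables (S : nzRingType) (sigma : {rmorphism S -> S}).
Implicit Types (p q r : skewpoly sigma).

HB.instance Definition _ := GRing.Zmodule.on (skewpoly sigma).

Definition skew_mul p q : skewpoly sigma :=
  \poly_(k < (size p + size q).-1)
    \sum_(i < k.+1) p`_i * iter i sigma q`_(k - i).

Fact iter_sigma0 i : iter i sigma 0 = 0.
Proof. by elim: i => //= i ->; rewrite rmorph0. Qed.

Fact iter_sigma1 i : iter i sigma 1 = 1.
Proof. by elim: i => //= i ->; rewrite rmorph1. Qed.

Fact iter_sigmaD i x y :
  iter i sigma (x + y) = iter i sigma x + iter i sigma y.
Proof. by elim: i => //= i ->; rewrite rmorphD. Qed.

Fact iter_sigmaM i x y :
  iter i sigma (x * y) = iter i sigma x * iter i sigma y.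
Proof. by elim: i => //= i ->; rewrite rmorphM. Qed.

Fact iter_sigma_sum i n (F : 'I_n -> S) :
  iter i sigma (\sum_(j < n) F j) = \sum_(j < n) iter i sigma (F j).
Proof.
exact: (big_morph (iter i sigma) (iter_sigmaD i) (iter_sigma0 i)).
Qed.

Fact coef_skew_mul p q k :
  (skew_mul p q)`_k = \sum_(i < k.+1) p`_i * iter i sigma q`_(k - i).
Proof.
rewrite coef_poly ltn_predRL; case: leqP => // le_pq_k1.
rewrite big1 // => j _; have [lq_p_j|lt_j_p] := leqP (size p) j.
  by rewrite nth_default ?mul0r.
rewrite [q`__]nth_default ?iter_sigma0 ?mulr0 // leq_subRL -ltnS //.
by rewrite (leq_trans _ le_pq_k1) // ltn_add2r.
Qed.

Fact coef_skew_mul_rev p q k :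
  (skew_mul p q)`_k = \sum_(i < k.+1) p`_(k - i) * iter (k - i) sigma q`_i.
Proof.
rewrite coef_skew_mul (reindex_inj rev_ord_inj) /=.
by apply: eq_bigr => j _; rewrite (sub_ordK j).
Qed.

Fact skew_mulA : associative skew_mul.
Proof.
move=> p q r; apply/polyP=> i; rewrite coef_skew_mul coef_skew_mul_rev.
pose coef3 j k :=
  p`_j * iter j sigma (q`_(i - j - k) * iter (i - j - k) sigma r`_k).
transitivity (\sum_(j < i.+1) \sum_(k < i.+1 | (k <= i - j)%N) coef3 j k).
  apply: eq_bigr => /= j _.
  rewrite coef_skew_mul_rev iter_sigma_sum big_distrr /=.
  by rewrite (big_ord_narrow_leq (leq_subr _ _)).
rewrite (exchange_big_dep predT) //=; apply: eq_bigr => k _.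
transitivity (\sum_(j < i.+1 | (j <= i - k)%N) coef3 j k).
  apply: eq_bigl => j; rewrite -ltnS -(ltnS j) -!subSn ?leq_ord //.
  by rewrite -subn_gt0 -(subn_gt0 j) -!subnDA addnC.
rewrite (big_ord_narrow_leq (leq_subr _ _)) coef_skew_mul big_distrl /=.
apply: eq_bigr => j _; rewrite /coef3 iter_sigmaM -iterD mulrA.
have lji : (j <= i - k)%N by rewrite -ltnS.
by rewrite subnAC (subnKC lji).
Qed.

Fact skew_mul1p : left_id (1%:P : skewpoly sigma) skew_mul.
Proof.
move=> p; apply/polyP => i; rewrite coef_skew_mul big_ord_recl subn0.
by rewrite big1 => [|j _]; rewrite coefC /= ?mul0r // mul1r addr0.
Qed.

Fact skew_mulp1 : right_id (1%:P : skewpoly sigma) skew_mul.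
Proof.
move=> p; apply/polyP => i; rewrite coef_skew_mul_rev big_ord_recl subn0.
rewrite big1 => [|j _]; rewrite coefC /= ?iter_sigma0 ?mulr0 //.
by rewrite iter_sigma1 mulr1 addr0.
Qed.

Fact skew_mulDl : left_distributive skew_mul +%R.
Proof.
move=> p q r; apply/polyP=> i; rewrite coefD !coef_skew_mul -big_split.
by apply: eq_bigr => j _; rewrite coefD mulrDl.
Qed.

Fact skew_mulDr : right_distributive skew_mul +%R.
Proof.
move=> p q r; apply/polyP=> i; rewrite coefD !coef_skew_mul -big_split.
by apply: eq_bigr => j _; rewrite coefD iter_sigmaD mulrDr.
Qed.

Fact skew_1neq0 : (1%:P : skewpoly sigma) != 0.
Proof. by rewrite polyC_eq0 oner_neq0. Qed.

HB.instance Definition _ := GRing.Zmodule_isNzRing.Build (skewpoly sigma)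
  skew_mulA skew_mul1p skew_mulp1 skew_mulDl skew_mulDr skew_1neq0.

Definition skewC (c : S) : skewpoly sigma := c%:P.
Definition skewX : skewpoly sigma := 'X.

Lemma coef_skewM p q k :
  (p * q)`_k = \sum_(i < k.+1) p`_i * iter i sigma q`_(k - i).
Proof. exact: coef_skew_mul. Qed.

Lemma coef_skewXM p k :
  (skewX * p)`_k = if k is k'.+1 then sigma p`_k' else 0.
Proof.
rewrite coef_skewM; case: k => [|k]; first by rewrite big_ord1 coefX mul0r.
rewrite !big_ord_recl big1 => [|j _]; last by rewrite coefX /= mul0r.
by rewrite !coefX /= mul0r mul1r add0r addr0 subSS subn0.
Qed.

Lemma coef_skewXnM p n k :
  (skewX ^+ n * p)`_k = if (k < n)%N then 0 else iter n sigma p`_(k - n).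
Proof.
elim: n k => [|n IHn] k; first by rewrite expr0 mul1r subn0.
rewrite exprS -mulrA coef_skewXM; case: k => [//|k].
by rewrite IHn ltnS subSS; case: ifP => //=; rewrite rmorph0.
Qed.

Lemma coef_skewCM c p k : (skewC c * p)`_k = c * p`_k.
Proof.
rewrite coef_skewM big_ord_recl subn0 big1 ?addr0 => [|j _].
  by rewrite coefC.
by rewrite coefC /= mul0r.
Qed.

Lemma skewXC c : skewX * skewC c = skewC (sigma c) * skewX.
Proof.
apply/polyP=> k; rewrite coef_skewCM coef_skewXM coefX.
by case: k => [|[|k]]; rewrite ?coefC /= ?rmorph0 ?mulr0 ?mulr1.
Qed.

Lemma coef_skew_monomial c n k :
  (skewC c * skewX ^+ n)`_k = if k == n then c else 0.
Proof.
rewrite -[skewX ^+ n]mulr1 coef_skewCM coef_skewXnM coefC subn_eq0.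
case: (ltngtP k n) => _ /=; rewrite ?iter_sigma0 ?mulr0 //.
by rewrite iter_sigma1 mulr1.
Qed.

(* skew_mod f g is the remainder r of the right division g = q f + r.         *)
(* It is only meaningful for monic f.                                         *)
Fixpoint skew_mod_rec (f : skewpoly sigma) (k : nat) (g : skewpoly sigma) :
    skewpoly sigma :=
  if k is k'.+1 then
    if (size f <= size g)%N then
      skew_mod_rec f k'
        (g - skewC (lead_coef g) * skewX ^+ (size g - size f) * f)
    else g
  else g.

Definition skew_mod (f g : skewpoly sigma) : skewpoly sigma :=
  skew_mod_rec f (size g) g.

Lemma size_skew_mul_monic (f q : skewpoly sigma) :
  (f : {poly S}) \is monic -> q != 0 -> (size f <= size (q * f)%R)%N.
Proof.
move=> /monicP f1 q0; rewrite leqNgt; apply/negP => lt_qf.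
have f0 : (0 < size f)%N.
  rewrite lt0n size_poly_eq0; apply: contra_neq (oner_neq0 S) => f0.
  by rewrite -f1 f0 lead_coef0.
have qs : (0 < size q)%N by rewrite lt0n size_poly_eq0.
have lt_q : ((size q).-1 < ((size q).-1 + (size f).-1).+1)%N.
  by rewrite ltnS leq_addr.
case/eqP: q0; apply/eqP; rewrite -lead_coef_eq0; apply/eqP.
have: (q * f)`_((size q).-1 + (size f).-1) = 0.
  by rewrite nth_default // -ltnS (leq_trans lt_qf) // -{1}(prednK f0) ltnS
    leq_addl.
rewrite coef_skewM (bigD1 (Ordinal lt_q)) //= addKn.
rewrite -/(lead_coef f) f1 iter_sigma1 mulr1 big1 ?addr0 // => i.
rewrite -val_eqE /= neq_ltn => /orP[lt_i|lt_i].
  rewrite [f`__]nth_default ?iter_sigma0 ?mulr0 //.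
  by move: lt_i f0; move: (size f) (size q) (nat_of_ord i); lia.
by rewrite nth_default ?mul0r //; move: lt_i qs; lia.
Qed.

Lemma skew_divP (f g : skewpoly sigma) : (f : {poly S}) \is monic ->
  (size (skew_mod f g) < size f)%N /\ exists q, g = q * f + skew_mod f g.
Proof.
move=> fm; rewrite /skew_mod.
have f0 : (0 < size f)%N by rewrite size_poly_gt0 monic_neq0.
have: (size g <= size g)%N by []; move: {2 3 4}(size g) => k.
elim: k g => [|k IHk] g.
  move=> g0 /=; split; first exact: leq_ltn_trans g0 f0.
  by exists 0; rewrite mul0r add0r.
move=> le_gk /=; case: (leqP (size f) (size g)) => [le_fg|lt_gf]; last first.
  by split; [exact: lt_gf | exists 0; rewrite mul0r add0r].
set c := skewC _ * _.
have [|lt_rf [q def_g]] := IHk (g - c * f).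
  apply/leq_sizeP => i le_ki; rewrite coefB -mulrA coef_skewCM coef_skewXnM.
  have [lt_i|le_i] := ltnP i (size g - size f).
    by move: lt_i le_ki le_gk le_fg f0; lia.
  have [lt_gi|le_gi] := ltnP i (size g).
    have -> : i = (size g).-1 by move: lt_gi le_ki le_gk; lia.
    have -> : ((size g).-1 - (size g - size f) = (size f).-1)%N.
      by move: f0 le_fg; lia.
    by rewrite -/(lead_coef f) (monicP fm) iter_sigma1 mulr1 subrr.
  rewrite !nth_default ?iter_sigma0 ?mulr0 ?subr0 //.
  by move: le_gi le_i le_fg; move: (size f) (size g); lia.
split=> //; exists (q + c).
by rewrite mulrDl addrAC -def_g subrK.
Qed.

Lemma skew_modP (f g q r : skewpoly sigma) : (f : {poly S}) \is monic ->
  g = q * f + r -> (size r < size f)%N -> skew_mod f g = r.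
Proof.
move=> fm def_g lt_rf; have [lt_mf [q' def_g']] := skew_divP g fm.
apply/eqP; rewrite -subr_eq0.
have eq_qr : q * f + r = q' * f + skew_mod f g by rewrite -def_g.
have E : skew_mod f g - r = (q - q') * f.
  by rewrite mulrBl -[skew_mod f g](addKr (q' * f)) -eq_qr addrA addrK addrC.
case: (eqVneq (q - q') 0) => [q0|q0]; first by rewrite E q0 mul0r.
have := size_skew_mul_monic fm q0; rewrite -E leqNgt => /negP[].
by rewrite (leq_ltn_trans (size_polyD _ _)) // size_polyN gtn_max lt_mf.
Qed.

End SkewPoly.

Arguments skewC {S} sigma c.
Arguments skewX {S} sigma.

Section Petit.

Variables (S : nzRingType) (sigma : {rmorphism S -> S}).
Implicit Types (f g : skewpoly sigma).

(* The degree of f is (size f).-1, so this is deg g < deg f.                  *)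
Definition small_skewpoly f : {pred skewpoly sigma} :=
  fun g => (size g <= (size f).-1)%N.

Fact small_skewpoly_closed f : zmod_closed (small_skewpoly f).
Proof.
split=> [|x y sx sy]; first by rewrite unfold_in size_poly0.
rewrite unfold_in (leq_trans (size_polyD _ _)) // size_polyN geq_max.
by apply/andP.
Qed.

HB.instance Definition _ f :=
  GRing.isZmodClosed.Build (skewpoly sigma) (small_skewpoly f)
    (small_skewpoly_closed f).

(* The Petit ring S_f, for f monic. It is nonassociative, hence a zmodType    *)
(* with a separate product.                                                   *)
Record petit f := Petit {
  petit_val :> skewpoly sigma;
  _ : petit_val \in small_skewpoly f
}.

HB.instance Definition _ f := [isSub for @petit_val f].
HB.instance Definition _ f := [Choice of petit f by <:].
HB.instance Definition _ f := [SubChoice_isSubZmodule of petit f by <:].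

(* The default 0 is only reached for f not monic (petit_ofE).                 *)
Definition petit_of f g : petit f := insubd 0 (skew_mod f g).

Definition petit_mul f (x y : petit f) : petit f :=
  petit_of f (petit_val x * petit_val y).

Lemma petit_ofE (f g : skewpoly sigma) : (f : {poly S}) \is monic ->
  petit_val (petit_of f g) = skew_mod f g.
Proof.
move=> fm; have [lt_mf _] := skew_divP g fm.
have small_m : skew_mod f g \in small_skewpoly f.
  by rewrite unfold_in -ltnS (ltn_predK lt_mf).
by rewrite [LHS]val_insubd small_m.
Qed.

Lemma petit_of_small (f g : skewpoly sigma) : (f : {poly S}) \is monic ->
  (size g < size f)%N -> petit_val (petit_of f g) = g.
Proof.
move=> fm lt_gf; rewrite petit_ofE //.
by apply: (skew_modP (q := 0)); rewrite // mul0r add0r.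
Qed.

End Petit.

(* Ring homomorphisms S_f -> S_h; preservation of 1 is not required.          *)
Definition petit_hom (S : nzRingType) (sigma : {rmorphism S -> S})
    (f h : skewpoly sigma) (G : petit f -> petit h) : Prop :=
  zmod_morphism G /\
  forall x y, G (petit_mul x y) = petit_mul (G x) (G y).

Definition skew_is_monomial (S : nzRingType) (sigma : {rmorphism S -> S})
    (g : skewpoly sigma) : Prop :=
  exists (c : S) (i : nat), g = skewC sigma c * skewX sigma ^+ i.

Definition has_finite_order (T : Type) (s : T -> T) (m : nat) : Prop :=
  [/\ (0 < m)%N, iter m s =1 id &
      forall k, (0 < k < m)%N -> ~ (iter k s =1 id)].

(* Main.v *)
Require Import Defs.
From HB Require Import structures.
From mathcomp Require Import all_boot all_order all_algebra zify.

(* Put g = G(t). Applying G to t^j c = sigma^j(c) t^j for j < n shows that    *)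
(* G(t^j) only involves degrees congruent to j modulo m. If m does not divide *)
(* n, reducing modulo t^n - b shifts degrees by -n, which is nonzero modulo   *)
(* m, so no reduction can occur when computing G(t^j): it is the plain power  *)
(* g^j in S[t; sigma], of degree j deg g < n. For j = n - 1 this forces       *)
(* deg g <= 1, hence g = c t, which was excluded. If m divides n, p is read   *)
(* off from the support of g.                                                 *)

Set Implicit Arguments.
Unset Strict Implicit.
Unset Printing Implicit Defensive.

Import GRing.Theory.
Local Open Scope ring_scope.

(** Degree modulo m grades [S[t; sigma]], and commutation with constants detects the grading: over a
    domain, g c = sigma^j(c) g for all c puts the support of g in the class of j
    ([skew_homog_commC]). A homomorphism acting as [tau] on S therefore sends t^j, j < n, into class
    j ([skew_homog_of_hom]). If m does not divide n, then t^n and b lie in different classes, so a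
    genuine reduction of a homogeneous product would create a term of the wrong class
    ([size_homog_skew_mod]). Powers of G(t) up to n - 1 are then ordinary ones, and degrees force
    G(t) to be linear, even a monomial. If m divides n, [skew_poly_supp1] reads class 1 as p(t^m)t;
    a constant term, possible only for m = 1, is absorbed through t^n = b. *)

Lemma eqmod_of_iter (T : Type) (s : T -> T) (m i j : nat) :
  injective s -> has_finite_order s m ->
  iter i s =1 iter j s -> i = j %[mod m].
Proof.
move=> s_inj [m0 sm sk].
have iter_inj k : injective (iter k s).
  by elim: k => [|k IHk] x y //= /s_inj /IHk.
have sM k : iter (k * m) s =1 id.
  by elim: k => [|k IHk] x //; rewrite mulSn iterD IHk sm.
wlog le_ij : i j / (i <= j)%N => [wl|].
  case/orP: (leq_total i j) => le_ij eq_ij; first exact: wl.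
  by apply/esym/wl => // x; rewrite eq_ij.
move=> eq_ij; apply/esym/eqP; rewrite eqn_mod_dvd //; apply/eqP.
have id_ij : iter (j - i) s =1 id.
  by move=> x; apply: (iter_inj i); rewrite -iterD subnKC // eq_ij.
(* The remainder also iterates [s] to the identity, so minimality of m makes it 0. *)
have : iter ((j - i) %% m) s =1 id.
  by move=> x; rewrite -[RHS]id_ij [in RHS](divn_eq (j - i) m) iterD sM.
have [//|lt0 id_mod] := posnP ((j - i) %% m).
by case: (sk _ _ id_mod); rewrite lt0 ltn_mod.
Qed.

(** * Coefficients, degrees and the grading modulo m *)

Section SkewCoefficients.

Variables (S : nzRingType) (sigma : {rmorphism S -> S}).
Implicit Types (p q g : skewpoly sigma).

Lemma ltn_size_coef p k : p`_k != 0 -> (k < size p)%N.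
Proof. by apply: contraNltn => /leq_sizeP ->. Qed.

Lemma coef_skewXn n k : (skewX sigma ^+ n)`_k = (k == n)%:R.
Proof.
have := coef_skew_monomial sigma 1 n k.
by rewrite mul1r => ->; case: eqP.
Qed.

Lemma coef_skewMXn p n k :
  (p * skewX sigma ^+ n)`_k = if (k < n)%N then 0 else p`_(k - n).
Proof.
rewrite coef_skewM; case: ltnP => [lt_kn|le_nk].
  rewrite big1 // => i _; rewrite coef_skewXn.
  have /negPf -> : (k - i != n)%N by lia.
  by rewrite iter_sigma0 mulr0.
have lt_k : (k - n < k.+1)%N by lia.
rewrite (bigD1 (Ordinal lt_k)) //= coef_skewXn subKn // eqxx iter_sigma1 mulr1.
rewrite big1 ?addr0 // => i; rewrite -val_eqE /= coef_skewXn => ne_i.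
have /negPf -> : (k - i != n)%N by have := ltn_ord i; lia.
by rewrite iter_sigma0 mulr0.
Qed.

Lemma coef_skewMC p c k : (p * skewC sigma c)`_k = p`_k * iter k sigma c.
Proof.
rewrite coef_skewM big_ord_recr /= subnn coefC /= big1 ?add0r // => i _.
rewrite coefC; have /negPf -> : (k - i != 0)%N by have := ltn_ord i; lia.
by rewrite iter_sigma0 mulr0.
Qed.

Lemma skewXnC n c :
  skewX sigma ^+ n * skewC sigma c =
  skewC sigma (iter n sigma c) * skewX sigma ^+ n.
Proof.
elim: n => [|n IHn]; first by rewrite expr0 mul1r mulr1.
by rewrite exprS -mulrA IHn mulrA skewXC -mulrA.
Qed.

Lemma size_skewXn n : size (skewX sigma ^+ n) = n.+1.
Proof.
rewrite -(size_polyXn S n); congr (size (polyseq _)).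
by apply/polyP => k; rewrite coef_skewXn coefXn.
Qed.

Lemma coef_skewXn_subC n (b : S) k :
  (skewX sigma ^+ n - skewC sigma b)`_k =
  (k == n)%:R - (if k == 0 then b else 0).
Proof. by rewrite coefB coef_skewXn coefC. Qed.

Lemma size_skewXn_subC n (b : S) : (0 < n)%N ->
  size (skewX sigma ^+ n - skewC sigma b) = n.+1.
Proof.
move=> n0; apply/eqP; rewrite eqn_leq; apply/andP; split.
  apply/leq_sizeP => k lt_nk; rewrite coef_skewXn_subC.
  have /negPf -> : (k != n)%N by lia.
  have /negPf -> : (k != 0)%N by lia.
  by rewrite subrr.
apply: ltn_size_coef; rewrite coef_skewXn_subC eqxx.
have /negPf -> : (n != 0)%N by lia.
by rewrite subr0 oner_neq0.
Qed.

Lemma skewXn_subC_monic n (b : S) : (0 < n)%N ->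
  (skewX sigma ^+ n - skewC sigma b : {poly S}) \is monic.
Proof.
move=> n0; apply/monicP; rewrite /lead_coef size_skewXn_subC //=.
rewrite coef_skewXn_subC eqxx.
have /negPf -> : (n != 0)%N by lia.
by rewrite subr0.
Qed.

Lemma coef_skewM_Xn_subC q n (b : S) k :
  (q * (skewX sigma ^+ n - skewC sigma b))`_k =
  (if (k < n)%N then 0 else q`_(k - n)) - q`_k * iter k sigma b.
Proof. by rewrite mulrBr coefB coef_skewMXn coef_skewMC. Qed.

Lemma size_skewMC p c : (size (p * skewC sigma c)%R <= size p)%N.
Proof.
by apply/leq_sizeP => k /leq_sizeP pk; rewrite coef_skewMC pk ?mul0r.
Qed.

Lemma size_skewCM p c : (size (skewC sigma c * p)%R <= size p)%N.
Proof.
by apply/leq_sizeP => k /leq_sizeP pk; rewrite coef_skewCM pk ?mulr0.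
Qed.

Lemma size_skewM_leq p q :
  (size (p * q)%R <= (size p + size q).-1)%N.
Proof. exact: size_poly. Qed.

Lemma petit_mul_small (h : skewpoly sigma) (x y : petit h) :
  (h : {poly S}) \is monic ->
  (size (petit_val x * petit_val y)%R < size h)%N ->
  petit_val (petit_mul x y) = petit_val x * petit_val y.
Proof. exact: petit_of_small. Qed.

Lemma size_petit (h : skewpoly sigma) (x : petit h) :
  (size (petit_val x) <= (size h).-1)%N.
Proof. by case: x. Qed.

(** The class r component of the grading by Z/m; zero belongs to every class. *)
Definition skew_homog (m r : nat) p : Prop :=
  forall i, p`_i != 0 -> i = r %[mod m].

Lemma skew_homogM m r s p q :
  skew_homog m r p -> skew_homog m s q -> skew_homog m (r + s) (p * q).
Proof.
move=> hp hq k; rewrite coef_skewM => nz.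
have [i] : exists i : 'I_k.+1, p`_i * iter i sigma q`_(k - i) != 0.
  apply/existsP; apply: contraNT nz; rewrite negb_exists => /forallP z.
  by rewrite big1 // => i _; apply/eqP; rewrite -[_ == _]negbK.
case: (eqVneq p`_i 0) => [->|/hp pi]; first by rewrite mul0r eqxx.
case: (eqVneq q`_(k - i) 0) => [->|/hq qi _].
  by rewrite iter_sigma0 mulr0 eqxx.
have le_ik : (i <= k)%N by rewrite -ltnS.
by rewrite -(subnKC le_ik) -modnDm pi qi modnDm.
Qed.

End SkewCoefficients.

(** * Degrees and homogeneity over a domain *)

Section SkewDomain.

Variables (S : idomainType) (sigma : {rmorphism S -> S}).
Hypothesis sigma_inj : injective sigma.
Implicit Types (p q g : skewpoly sigma).

Lemma iter_sigma_eq0 i x : (iter i sigma x == 0) = (x == 0).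
Proof.
by elim: i => //= i <-; rewrite -[0 in LHS](rmorph0 sigma) (inj_eq sigma_inj).
Qed.

(** The top coefficient of the product is lead(p) sigma^(deg p)(lead(q)), nonzero because [sigma] is
    injective and S is a domain. *)
Lemma size_skewM p q : p != 0 -> q != 0 ->
  size (p * q) = (size p + size q).-1.
Proof.
move=> p0 q0; apply/eqP; rewrite eqn_leq size_skewM_leq /=.
have ps : (0 < size p)%N by rewrite lt0n size_poly_eq0.
have qs : (0 < size q)%N by rewrite lt0n size_poly_eq0.
have -> : ((size p + size q).-1 = ((size p).-1 + (size q).-1).+1)%N by lia.
apply: ltn_size_coef.
have lt_p : ((size p).-1 < ((size p).-1 + (size q).-1).+1)%N by lia.
rewrite coef_skewM (bigD1 (Ordinal lt_p)) //= addKn big1 ?addr0.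
  by rewrite mulf_eq0 iter_sigma_eq0 -/(lead_coef p) -/(lead_coef q)
    !lead_coef_eq0 negb_or p0.
move=> i; rewrite -val_eqE /= neq_ltn => /orP[lt_i|lt_i].
  rewrite [q`__]nth_default ?iter_sigma0 ?mulr0 //.
  by move: lt_i ps qs; move: (size p) (size q) (nat_of_ord i); lia.
rewrite nth_default ?mul0r //.
by move: lt_i ps; move: (size p) (nat_of_ord i); lia.
Qed.

Lemma skewM_neq0 p q : p != 0 -> q != 0 -> p * q != 0.
Proof.
move=> p0 q0; rewrite -size_poly_gt0 size_skewM //.
by move: p0 q0; rewrite -!size_poly_gt0; lia.
Qed.

(* Reduction by t^n = b moves the degrees >= n of w into degrees congruent to *)
(* r - n, which differs from r modulo m; so there are no such degrees.        *)
Lemma size_homog_skew_mod m r n (b : S) (w : skewpoly sigma) :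
  (0 < n)%N -> b != 0 -> ~~ (m %| n)%N -> (size w < n.*2)%N ->
  skew_homog m r w ->
  skew_homog m r (skew_mod (skewX sigma ^+ n - skewC sigma b) w) ->
  (size w <= n)%N.
Proof.
set h := _ - _ => n0 b0 ndiv size_w hw.
have [] := skew_divP w (skewXn_subC_monic sigma b n0).
rewrite -/h size_skewXn_subC //; set r0 := skew_mod h w => size_r0 [q def_w] hr.
have hs : size h = n.+1 by rewrite size_skewXn_subC.
case: (eqVneq q 0) => [q0|q0].
  by rewrite def_w q0 mul0r add0r -ltnS.
have h0 : h != 0 by rewrite -size_poly_gt0 hs.
have qs : (0 < size q)%N by rewrite lt0n size_poly_eq0.
(* As deg w < 2n, the quotient has degree below n, so q t^n has no term where q b has its leading
   one. *)
have size_q : (size q < n.+1)%N.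
  have : (size (q * h)%R < n.*2.+1)%N.
    have -> : q * h = w - r0 by rewrite def_w addrK.
    rewrite (leq_ltn_trans (size_polyD _ _)) // size_polyN gtn_max.
    by apply/andP; split; move: size_w size_r0 n0; lia.
  by rewrite size_skewM // hs; lia.
(* The leading coefficient of q survives twice: in w at degree s + n and, since w then has no term
   of degree s, in the remainder at degree s, times sigma^s(b). *)
pose s := (size q).-1.
have qs0 : q`_s != 0 by rewrite -/(lead_coef q) lead_coef_eq0.
have sn_r : (s + n)%N = r %[mod m].
  apply: hw; rewrite def_w coefD coef_skewM_Xn_subC.
  rewrite [r0`_ _]nth_default ?addr0; last exact: leq_trans (leq_addl _ _).
  rewrite ltnNge leq_addl addnK /= [q`_(s + n)]nth_default ?mul0r ?subr0 //.
  exact: leq_trans (leq_addl _ _).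
have ne_sr : s = r %[mod m] -> False.
  move=> /eqP; rewrite -sn_r eq_sym -[X in _ == X %[mod _]]addn0.
  by rewrite eqn_modDl mod0n; exact/negP.
have ws0 : w`_s = 0 by apply/eqP; rewrite -[_ == _]negbK; apply/negP => /hw.
case: ne_sr; apply: hr.
have lt_sn : (s < n)%N by rewrite /s; lia.
have -> : r0`_s = w`_s - (q * h)`_s by rewrite def_w coefD addrAC subrr add0r.
rewrite ws0 coef_skewM_Xn_subC lt_sn !sub0r opprK.
by rewrite mulf_eq0 iter_sigma_eq0 negb_or qs0.
Qed.

(** Comparing coefficients of t^i and cancelling g_i gives sigma^i = sigma^j, hence i and j agree
    modulo the order. *)
Lemma skew_homog_commC m j g : has_finite_order sigma m ->
  (forall c, g * skewC sigma c = skewC sigma (iter j sigma c) * g) ->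
  skew_homog m j g.
Proof.
move=> ord comm i gi; apply: (eqmod_of_iter sigma_inj ord) => c.
have /(congr1 (fun p : skewpoly sigma => p`_i)) := comm c.
rewrite coef_skewMC coef_skewCM mulrC => /(mulIf gi); exact.
Qed.

End SkewDomain.

(** * Polynomials of given support, and images of powers of t *)

Lemma skew_eq_monomial (S : nzRingType) (sigma : {rmorphism S -> S})
    (g : skewpoly sigma) (i : nat) :
  (forall k, g`_k != 0 -> k = i) -> skew_is_monomial g.
Proof.
move=> gi; exists g`_i, i; apply/polyP => k; rewrite coef_skew_monomial.
case: eqP => [-> //|ne]; apply/eqP; rewrite -[_ == _]negbK.
by apply/negP => /gi.
Qed.

Lemma skew_poly_supp1 (S : nzRingType) (sigma : {rmorphism S -> S})
    (m d : nat) (g : skewpoly sigma) : (0 < m)%N ->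
  (size g <= (m * d).+1)%N ->
  (forall k, g`_k != 0 -> exists j, k = (m * j + 1)%N) ->
  let p := \poly_(j < d) g`_(m * j + 1) in
  g = \sum_(j < size p) skewC sigma p`_j * skewX sigma ^+ (m * j + 1).
Proof.
move=> m0 size_g supp p; apply/polyP => k.
transitivity (\sum_(j < size p) if k == (m * j + 1)%N then p`_j else 0).
  have [[j kj]|nk] : (exists j, k = m * j + 1)%N \/ g`_k = 0.
    by case: (eqVneq g`_k 0) => [|/supp]; [right | left].
  - have pj : p`_j = g`_k.
      rewrite coef_poly -kj; case: ltnP => // le_dj.
      rewrite nth_default // (leq_trans size_g) // kj addn1 ltnS.
      by rewrite leq_mul2l le_dj orbT.
    (* The sum stops at [size p], which may be below d; beyond it the coefficient of g vanishes. *)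
    case: (ltnP j (size p)) => [lt_j|le_j].
      rewrite (bigD1 (Ordinal lt_j)) //= kj eqxx -kj pj big1 ?addr0 // => i.
      rewrite -val_eqE /= kj eqn_add2r eqn_pmul2l // eq_sym.
      by move/negPf ->.
    rewrite -pj nth_default // big1 // => i _; case: eqP => // eq_k.
    have : (m * j + 1 = m * i + 1)%N by rewrite -kj.
    move/eqP; rewrite eqn_add2r eqn_pmul2l // => /eqP eq_ji.
    by have := ltn_ord i; rewrite -eq_ji ltnNge le_j.
  - rewrite nk big1 // => i _; case: eqP => // eq_k.
    by rewrite coef_poly -eq_k nk; case: ifP.
have coef_add : {morph (fun q : skewpoly sigma => q`_k) : x y / x + y}.
  by move=> x y; rewrite coefD.
rewrite (big_morph (fun q : skewpoly sigma => q`_k) coef_add (coef0 _ _)).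
by apply: eq_bigr => j _; rewrite coef_skew_monomial.
Qed.

Lemma skew_homog_of_hom (S : idomainType) (sigma : {rmorphism S -> S})
    (m n j : nat) (f h : skewpoly sigma) (G : petit f -> petit h)
    (tau : {rmorphism S -> S}) :
  injective sigma -> has_finite_order sigma m ->
  (f : {poly S}) \is monic -> size f = n.+1 ->
  (h : {poly S}) \is monic -> size h = n.+1 -> (j < n)%N ->
  petit_hom G -> bijective tau ->
  (forall c, tau (sigma c) = sigma (tau c)) ->
  (forall c, G (petit_of f (skewC sigma c)) =
             petit_of h (skewC sigma (tau c))) ->
  skew_homog m j (petit_val (G (petit_of f (skewX sigma ^+ j)))).
Proof.
move=> sigma_inj ord fm fs hm hs lt_jn [_ GM] [tau' _ tau'K] tau_sigma GC.
set x := petit_of f _; set g := petit_val _.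
have size_g : (size g <= n)%N by rewrite (leq_trans (size_petit _)) ?hs.
have size_C c : (size (skewC sigma c) < n.+1)%N.
  by apply: leq_ltn_trans (size_polyC_leq1 _) _; lia.
have xE : petit_val x = skewX sigma ^+ j.
  by rewrite petit_of_small // fs size_skewXn.
have tau_iter i c : tau (iter i sigma c) = iter i sigma (tau c).
  by elim: i => //= i <-.
apply: (skew_homog_commC sigma_inj ord) => c'.
(* Surjectivity of [tau]: commutation with the values tau(c) suffices. *)
rewrite -(tau'K c'); move: (tau' c') => c.
have xC : petit_mul x (petit_of f (skewC sigma c)) =
    petit_mul (petit_of f (skewC sigma (iter j sigma c))) x.
  by rewrite /petit_mul !(petit_of_small (g := skewC _ _)) ?fs // xE skewXnC.
have /(congr1 (@petit_val _ _ _)) := congr1 G xC.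
have CE d : petit_val (petit_of h (skewC sigma d)) = skewC sigma d.
  by rewrite petit_of_small ?hs.
(* Multiplying by a constant does not raise the degree, so both products in the target are
   unreduced. *)
rewrite !GM !GC tau_iter !petit_mul_small // !CE ?hs //.
- by rewrite ltnS; exact: leq_trans (size_skewCM _ _) size_g.
- by rewrite ltnS; exact: leq_trans (size_skewMC _ _) size_g.
Qed.

(** * Divisibility of n by m, and the shape of G(t) *)

Theorem theorem6p1 (S : idomainType) (sigma : {rmorphism S -> S})
    (sigma_aut : bijective sigma)
    (m : nat) (sigma_order : has_finite_order sigma m)
    (n : nat) (f : skewpoly sigma)
    (f_monic : (f : {poly S}) \is monic) (f_degree : size f = n.+1)
    (b : S) (b_unit : b \is a GRing.unit)
    (G : petit f -> petit (skewX sigma ^+ n - skewC sigma b))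
    (G_hom : petit_hom G) (G_nonzero : exists x : petit f, G x <> 0)
    (tau : {rmorphism S -> S}) (tau_aut : bijective tau)
    (tau_sigma : forall c : S, tau (sigma c) = sigma (tau c))
    (G_restr : forall c : S,
       G (petit_of f (skewC sigma c)) =
       petit_of (skewX sigma ^+ n - skewC sigma b) (skewC sigma (tau c)))
    (G_t : ~ skew_is_monomial (petit_val (G (petit_of f (skewX sigma))))) :
  (m %| n)%N /\
  exists p : {poly S}, (size p <= n %/ m)%N /\
    G (petit_of f (skewX sigma)) =
    petit_of (skewX sigma ^+ n - skewC sigma b)
      (\sum_(j < size p) skewC sigma p`_j * skewX sigma ^+ (m * j + 1)).
Proof.
have sigma_inj := bij_inj sigma_aut.
have [m0 _ _] := sigma_order.
set h := skewX sigma ^+ n - skewC sigma b in G G_hom G_nonzero G_restr G_t *.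
have b0 : b != 0 by apply: contraTneq b_unit => ->; rewrite unitr0.
set g := petit_val _ in G_t.
have size_g0 : (size g <= (size h).-1)%N := size_petit _.
(* For n at most 1, G(t) would be constant. When n = 0 the modulus is 1 - b, so only an upper bound
   on [size h] is used. *)
have n2 : (1 < n)%N.
  rewrite ltnNge; apply/negP => n1; apply: G_t.
  apply: (skew_eq_monomial (i := 0%N)) => k /ltn_size_coef lt_k.
  have : (size h <= 2)%N.
    rewrite (leq_trans (size_polyD _ _)) // size_polyN geq_max size_skewXn.
    by rewrite ltnS n1 (leq_trans (size_polyC_leq1 _)).
  move: (leq_trans lt_k size_g0).
  by case: (size h) => [|[|[|?]]] //=; case: k {lt_k}.
have n0 : (0 < n)%N by exact: ltnW.
have hm : (h : {poly S}) \is monic by exact: skewXn_subC_monic.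
have hs : size h = n.+1 by exact: size_skewXn_subC.
have size_g : (size g <= n)%N by rewrite hs in size_g0.
have homog j : (j < n)%N ->
    skew_homog m j (petit_val (G (petit_of f (skewX sigma ^+ j)))).
  move=> lt_jn; exact: (skew_homog_of_hom sigma_inj sigma_order f_monic
    f_degree hm hs lt_jn G_hom tau_aut tau_sigma G_restr).
have hom_g : skew_homog m 1 g by exact: homog.
have g_n0 : g != 0.
  apply/eqP => g0; apply: G_t; apply: (skew_eq_monomial (i := 0%N)) => k.
  by rewrite g0 coef0 eqxx.
have m_dvd_n : (m %| n)%N.
  apply: contraT => ndiv; case: G_t.
  have powE j : (0 < j < n)%N ->
      petit_val (G (petit_of f (skewX sigma ^+ j))) = g ^+ j.
    elim: j => [//|[|j] IHj lt_j]; first by rewrite !expr1.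
    have lt_jn : (j.+1 < n)%N by case/andP: lt_j => _ /ltnW.
    have {}IHj := IHj lt_jn.
    have XS : petit_of f (skewX sigma ^+ j.+2) =
        petit_mul (petit_of f (skewX sigma)) (petit_of f (skewX sigma ^+ j.+1)).
      rewrite /petit_mul !petit_of_small ?f_degree ?size_skewXn ?exprS //.
      by rewrite -[skewX _]expr1 size_skewXn.
    have hom_j := homog _ lt_j.
    move: hom_j; rewrite XS (proj2 G_hom) /petit_mul petit_ofE // -/g IHj.
    rewrite -exprS => hom_j.
    have size_j : (size (g ^+ j.+1)%R <= n)%N.
      by rewrite -IHj (leq_trans (size_petit _)) ?hs.
    have hom_w : skew_homog m j.+2 (g ^+ j.+2).
      have := homog _ lt_jn; rewrite IHj [g ^+ j.+2]exprS.
      by rewrite -[j.+2]add1n; apply: skew_homogM.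
    (* Both factors g and g^(j+1) are reduced, so their product has degree at most 2n - 2. *)
    have size_w : (size (g ^+ j.+2)%R < n.*2)%N.
      rewrite exprS (leq_ltn_trans (size_skewM_leq _ _)) //.
      by move: size_j size_g n0; lia.
    have := size_homog_skew_mod sigma_inj n0 b0 ndiv size_w hom_w hom_j.
    rewrite -ltnS -hs => lt_w.
    by apply: (skew_modP (q := 0)); rewrite // mul0r add0r.
  have size_pow j : (size (g ^+ j)%R).-1 = (j * (size g).-1)%N /\ g ^+ j != 0.
    elim: j => [|j [IHj gj]].
      by rewrite expr0 oner_neq0 mul0n -(expr0 (skewX sigma)) size_skewXn.
    rewrite exprS; split; last exact: skewM_neq0.
    move: g_n0 gj; rewrite -!size_poly_gt0 => gp gjp.
    rewrite size_skewM -?size_poly_gt0 // mulSn -IHj.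
    by move: gp gjp; lia.
  (* The exponent n - 1 gives (n - 1) deg g <= n - 1, and n > 1. *)
  have size_g2 : (size g <= 2)%N.
    have lt_n1 : (0 < n.-1 < n)%N by lia.
    have : (size (g ^+ n.-1)%R <= n)%N.
      by rewrite -powE // (leq_trans (size_petit _)) ?hs.
    have [] := size_pow n.-1; move: (size g) (size _) => d e ed _ le_en.
    by nia.
  (* With m > 1, class 1 excludes degree 0, leaving only the term of degree 1. *)
  have m1 : (1 < m)%N.
    by rewrite ltn_neqAle m0 andbT eq_sym; apply: contraNneq ndiv => ->.
  apply: (skew_eq_monomial (i := 1%N)) => k gk.
  have := hom_g _ gk; have := leq_trans (ltn_size_coef gk) size_g2.
  by case: k {gk} => [|[|]] // _; rewrite mod0n modn_small.
split=> //.
(* Only for m = 1 can g have a constant term; it is then rewritten as         *)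
(* (g_0 / b) t^n, which is why p may reach degree n/m - 1 = n - 1.            *)
pose Q : skewpoly sigma := skewC sigma (g`_0 / b) * h + g.
have cQ k : Q`_k = g`_0 / b * ((k == n)%:R - (if k == 0 then b else 0)) + g`_k.
  by rewrite coefD coef_skewCM coef_skewXn_subC.
have size_Q : (size Q <= n.+1)%N.
  rewrite (leq_trans (size_polyD _ _)) // geq_max (leq_trans (size_skewCM _ _)).
    by rewrite (leq_trans size_g).
  by rewrite hs.
have supp_Q k : Q`_k != 0 -> exists j, k = (m * j + 1)%N.
  case: (posnP k) => [->|k0].
    have /negPf n_n0 : (0%N != n) by lia.
    by rewrite cQ n_n0 sub0r mulrN divrK // addNr eqxx.
  suff km : Q`_k != 0 -> k = 1%N %[mod m].
    move/km => /eqP; rewrite eqn_mod_dvd // => /dvdnP [j kj].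
    by exists j; rewrite mulnC -kj subnK.
  have /negPf k_n0 : (k != 0)%N by lia.
  rewrite cQ k_n0 subr0; case: (eqVneq k n) => [->|_]; last first.
    by rewrite mulr0 add0r => /hom_g.
  (* The added t^n term is present only if g_0 is nonzero; then 0 = 1 modulo m, so m = 1 and the
     congruence is trivial. *)
  case: (eqVneq g`_0 0) => [->|/hom_g m1].
    by rewrite !mul0r add0r => /hom_g.
  have m_dvd1 : (m %| 1)%N by rewrite /dvdn -m1 mod0n.
  by move=> _; move: m_dvd1; rewrite dvdn1 => /eqP ->; rewrite !modn1.
pose p := \poly_(j < n %/ m) Q`_(m * j + 1).
exists p; split; first exact: size_poly.
(* Since m divides n, deg Q <= n = m(n/m) is exactly the bound required for p. *)
rewrite -(skew_poly_supp1 m0) //; last by rewrite mulnC divnK.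
apply: val_inj; rewrite /= petit_ofE //; apply/esym.
by apply: (skew_modP (q := skewC sigma (g`_0 / b))); rewrite // hs ltnS.
Qed.
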